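(* Let $\boldsymbol{\varepsilon}=(\varepsilon_i)_{i=1}^n\in\mathbb{R}_+^n$ and, without loss of generality, suppose $\varepsilon_1\le\cdots\le\varepsilon_n\le 1$. Let $\mathcal{P}^*$ be the family of probability distributions $P$ of a real random variable $X$ such that $|X|\le\frac12$ almost surely, and let $\theta(P)=\mathbb{E}_{X\sim P}[X]$. (i) (Lower bound) There exists a universal positive constant $c_l$ such that $$\mathcal{L}_c(\mathcal{P}^*,\theta,\boldsymbol{\varepsilon})\ \ge\ c_l\left(\max_{k\in\{0,1,\dots,n\}}\frac{1}{n-k+\left(\sum_{i=1}^k\varepsilon_i\right)^2}\ \wedge\ 1\right).$$ (ii) (Upper bound) Moreover, there exist an $\boldsymbol{\varepsilon}$-centrally differentially private linear estimator $\hat\theta$ and a universal constant $c_u$ such that, for any $P\in\mathcal{P}^*$, $$\mathbb{E}_{(X_i\sim P)_{i=1}^n,\hat\theta}\left[\left|\hat\theta(X_{1:n})-\theta(P)\right|^2\right]\ \le\ c_u\max_{k\in\{0,1,\dots,n\}}\frac{\log(n+1)}{n-k+\left(\sum_{i=1}^k\varepsilon_i\right)^2}.$$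
   Context: $\mathbb{R}_+$ is the set of nonnegative reals, $x\wedge y=\min\{x,y\}$, and $1/0$ is read as $+\infty$. ''Universal'' means not depending on $n$, $\boldsymbol\varepsilon$ or $P$. The data space is $\mathcal{X}=[-\frac12,\frac12]$, and $X_{1:n}=(X_1,\dots,X_n)$ are i.i.d. samples from $P$. An estimator $\hat\theta$ is a (possibly randomized) real-valued measurable function on $\mathcal{X}^n$. Central differential privacy: a randomized algorithm $\mathcal{A}:\mathcal{X}^n\to\mathbb{R}$ is $\boldsymbol\varepsilon$-centrally differentially private if, for every $i$, every two datasets $\mathcal{S},\mathcal{S}'\in\mathcal{X}^n$ that differ in the $i$-th component, and every measurable $\mathcal{W}\subseteq\mathbb{R}$, $\mathbb{P}(\mathcal{A}(\mathcal{S})\in\mathcal{W})\le e^{\varepsilon_i}\,\mathbb{P}(\mathcal{A}(\mathcal{S}')\in\mathcal{W})$. Let $\mathcal{Q}_c(\boldsymbol\varepsilon)$ be the class of $\boldsymbol\varepsilon$-centrally differentially private estimators. Minimax error: $\mathcal{L}_c(\mathcal{P},\theta,\boldsymbol\varepsilon):=\inf_{\hat\theta\in\mathcal{Q}_c(\boldsymbol\varepsilon)}\sup_{P\in\mathcal{P}}\mathbb{E}_{(X_i\sim P)_{i=1}^n,\hat\theta}\left[|\hat\theta(X_{1:n})-\theta(P)|^2\right]$, the expectation being over the samples and the randomness of the estimator. Linear estimator (with Laplace mechanism): $\hat\theta(x_1,\dots,x_n)=\sum_{i=1}^n w_ix_i+\mathrm{Laplace}(1/\eta)$ with weights satisfying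 $\sum_{i=1}^n w_i=1$, where $\mathrm{Laplace}(b)$ denotes independent noise with density $\frac{1}{2b}e^{-|z|/b}$ on $\mathbb{R}$.
   Formalization: Part (ii) is stated assuming some ε_i > 0: if all ε_i = 0, no linear estimator with weights summing to 1 and genuine Laplace noise is 0-private, so the existence claim fails there. *)

(* Defs.v *)
From HB Require Import structures.
From mathcomp Require Import all_boot all_order all_algebra.
From mathcomp Require Import all_classical all_reals all_analysis.

Set Implicit Arguments.
Unset Strict Implicit.
Unset Printing Implicit Defensive.

Import Order.TTheory GRing.Theory Num.Theory.
Import numFieldNormedType.Exports.

Local Open Scope classical_set_scope.
Local Open Scope ring_scope.
Local Open Scope ereal_scope.

Section iid_samples.
Context d (T : measurableType d) (R : realType).

Definition tuple_cons n (z : T * n.-tuple T) : n.+1.-tuple T :=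
  [tuple of z.1 :: z.2].

Lemma measurable_tuple_cons n : measurable_fun [set: _] (@tuple_cons n).
Proof. exact: measurable_cons. Qed.

HB.instance Definition _ n :=
  isMeasurableFun.Build _ _ _ _ (@tuple_cons n) (@measurable_tuple_cons n).

(* The n-fold product P (x) ... (x) P: the joint law of n i.i.d. samples
   from P. *)
Fixpoint iid_law (P : probability T R) n : probability (n.-tuple T) R :=
  match n with
  | 0 => \d_([tuple] : 0.-tuple T)
  | n'.+1 => distribution (P \x iid_law P n') (@tuple_cons n')
  end.

Lemma iid_law_box (P : probability T R) n (A : 'I_n -> set T) :
  (forall i, measurable (A i)) ->
  iid_law P n [set x | forall i, A i (tnth x i)] = \prod_(i < n) P (A i).
Proof.
elim: n A => [|n IHn] A mA.
  rewrite big_ord0 /= diracE mem_set//.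
  by case.
rewrite big_ord_recl -(IHn (fun i => A (lift ord0 i)))//=.
rewrite /distribution /pushforward -product_measure1E//.
- congr product_measure1; apply/seteqP; split => -[a t] H.
  + split; first by have := H ord0; rewrite tnth0.
    by move=> i; have := H (lift ord0 i); rewrite tnthS.
  + move=> i; case: (unliftP ord0 i) => [j|] ->; rewrite ?tnthS ?tnth0.
      exact: H.2.
    exact: H.1.
- rewrite (_ : [set x | _] = \bigcap_(i in [set: 'I_n])
      ((@tnth n T)^~ i @^-1` A (lift ord0 i))); last first.
    by apply/seteqP; split => x H i; [move=> _; exact: H|exact: (H i I)].
  apply: fin_bigcap_measurable => // i _.
  by rewrite -[X in measurable X]setTI; exact: measurable_tnth.
Qed.

End iid_samples.

Section private_mean_estimation.
Context {R : realType}.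
Local Notation mR := (measurableTypeR R).

Definition data_space : set mR := `[(- 2^-1)%R, (2^-1)%R].

Definition bounded_laws : set (probability mR R) :=
  [set P | P [set x : mR | (`|x| <= 2^-1)%R] = 1].

Definition mean (P : probability mR R) : R := fine 'E_P[fun x : mR => x : R].

(* A randomized estimator is a Markov kernel: [A x] is the law of the output on
   the dataset x.  Kernels are indexed by all of R^n, but only their values on
   data_space^n matter: privacy is required for datasets in data_space^n only,
   and samples from a member of bounded_laws almost surely lie there.  Any
   kernel on data_space^n extends to R^n. *)
Definition estimator n := R.-pker (n.-tuple mR) ~> mR.

Definition datasets n : set (n.-tuple mR) :=
  [set x | forall i, data_space (tnth x i)].

Definition central_dp n (eps : 'I_n -> R) : set (estimator n) :=
  [set A : estimator n | forall (i : 'I_n) (x x' : n.-tuple mR),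
    datasets x -> datasets x' ->
    (forall j, j != i -> tnth x j = tnth x' j) ->
    forall W : set mR, measurable W -> A x W <= (expR (eps i))%:E * A x' W].

Definition mean_squared_error n (theta : probability mR R -> R)
    (A : estimator n) (P : probability mR R) : \bar R :=
  \int[iid_law P n]_x \int[A x]_y ((`|y - theta P| ^+ 2)%R)%:E.

Definition minimax_error n (F : set (probability mR R))
    (theta : probability mR R -> R) (eps : 'I_n -> R) : \bar R :=
  ereal_inf [set ereal_sup [set mean_squared_error theta A P | P in F]
            | A in central_dp eps].

Definition laplace_pdf (b z : R) : R := ((2 * b)^-1 * expR (- `|z| / b))%R.

Definition laplace_law (b : R) (W : set mR) : \bar R :=
  \int[lebesgue_measure]_(z in W) (laplace_pdf b z)%:E.

(* The Laplace scale 1 / eta must be a genuine finite scale, hence 0 < eta.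
   Consequently no linear estimator is private when all eps_i are 0: some
   w_i is nonzero, so the output law depends on x_i. *)
Definition linear_estimator n (w : 'I_n -> R) (eta : R) (A : estimator n) :=
  [/\ (\sum_(i < n) w i = 1)%R, (0 < eta)%R &
      forall (x : n.-tuple mR) (W : set mR), measurable W ->
        A x W = laplace_law eta^-1
                  [set z | W (\sum_(i < n) w i * tnth x i + z)%R]].

(* n - k + (eps_1 + ... + eps_k)^2.  It is injected into \bar R before being
   inverted, because there 0^-1 = +oo. *)
Definition effective_size n (eps : 'I_n -> R) (k : nat) : R :=
  ((n - k)%:R + (\sum_(i < n | (i < k)%N) eps i) ^+ 2)%R.

End private_mean_estimation.

(* Main.v *)
Require Import Defs.
From HB Require Import structures.
From mathcomp Require Import all_boot all_order all_algebra.
From mathcomp Require Import all_classical all_reals all_analysis.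
From mathcomp Require Import unstable measurable_realfun ring lra.

Set Implicit Arguments.
Unset Strict Implicit.
Unset Printing Implicit Defensive.

Import Order.TTheory GRing.Theory Num.Theory.
Import numFieldNormedType.Exports.

Local Open Scope classical_set_scope.
Local Open Scope ring_scope.
Local Open Scope ereal_scope.

(* Lower bound: Le Cam's method on the laws on {-1/2, 1/2} with means 0 and
   d / 2, where d ^ 2 is of order 1 / max(N, 1) and N is the effective size
   n - k + S ^ 2, S = eps_1 + ... + eps_k.  The two product laws are joined
   through the hybrid that is biased in the first k samples only.  Privacy
   bounds the effect of each of the first k samples on an output probability,
   for a total of order d * S; a chi-square computation bounds the effect of the
   remaining n - k samples in terms of (n - k) * d ^ 2.

   Upper bound: take w_i = min(eps_i, t) / s and Laplace noise of scale 1 / s,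
   with s the sum of the min(eps_j, t).  The error is of order
   (sum_i min(eps_i, t) ^ 2 + 1) / s ^ 2 <= (t * s + 1) / s ^ 2.  Choose t such
   that t * s = 1, or t = 1 when t * s < 1 there.  If t * s = 1 and k is the
   number of eps_i below t, then s = S + (n - k) * t gives
   s ^ 2 = s * S + n - k >= n - k + S ^ 2; if t = 1 then s = eps_1 + ... + eps_n.
   In both cases s ^ 2 >= N for some k, and the error is O(1 / N). *)

(** * Product laws and sums over tuples *)

Lemma integral_iid_lawS d (T : measurableType d) (R : realType)
    (P : probability T R) n (f : n.+1.-tuple T -> \bar R) :
  measurable_fun [set: n.+1.-tuple T] f -> (forall x, 0 <= f x) ->
  \int[iid_law P n.+1]_x f x =
  \int[P]_x \int[iid_law P n]_t f [tuple of x :: t].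
Proof.
move=> mf f0; rewrite /= ge0_integral_distribution//.
rewrite fubini_tonelli1//; last by move=> z; exact: f0.
by apply: (measurableT_comp mf); exact: measurable_tuple_cons.
Qed.

Section sums_over_tuples.
Variable R : comNzRingType.
Local Open Scope ring_scope.

Lemma sum_tuple_cons (V : nmodType) (I : finType) n (f : n.+1.-tuple I -> V) :
  \sum_s f s = \sum_b \sum_(t : n.-tuple I) f [tuple of b :: t].
Proof.
rewrite pair_bigA /=.
rewrite (reindex (fun p : I * n.-tuple I => [tuple of p.1 :: p.2])) //=.
exists (fun s => (thead s, [tuple of behead s])) => [[b t] _|s _] /=.
  by congr (_, _); exact/val_inj.
by rewrite [RHS]tuple_eta.
Qed.

Lemma sum_tuple_prod (I : finType) n (F : 'I_n -> I -> R) :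
  \sum_(s : n.-tuple I) \prod_i F i (tnth s i) = \prod_i \sum_b F i b.
Proof.
elim: n F => [|n IHn] F.
  rewrite big_ord0 (big_pred1 [tuple]) ?big_ord0// => s.
  by rewrite (tuple0 s) /= eqxx.
rewrite sum_tuple_cons big_ord_recl mulr_suml; apply: eq_bigr => b _.
rewrite -(IHn (fun i => F (lift ord0 i))) mulr_sumr; apply: eq_bigr => t _.
rewrite big_ord_recl tnth0; congr (_ * _).
by apply: eq_bigr => i _; rewrite tnthS.
Qed.

End sums_over_tuples.

Lemma card_ord_ge n k : (k <= n)%N ->
  #|(fun i : 'I_n => ~~ (i < k)%N)| = (n - k)%N.
Proof.
move=> kn; have ltE : #|(fun i : 'I_n => (i < k)%N)| = k.
  by rewrite -sum1_card -(big_ord_widen n (fun=> 1%N) kn) sum1_card card_ord.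
have := cardC (fun i : 'I_n => (i < k)%N); rewrite ltE card_ord => nE.
by rewrite -[in RHS]nE addKn.
Qed.

(** * Lower bound *)

Section sign_weights.
Variable R : realType.
Local Open Scope ring_scope.

Definition sgb (b : bool) : R := if b then 1 else -1.

(** The probability of [s] under independent signs, the [i]-th of mean [p i]. Biases may differ
    across coordinates so that hybrids are covered. *)
Definition weight n (p : 'I_n -> R) (s : n.-tuple bool) : R :=
  \prod_i ((1 + p i * sgb (tnth s i)) / 2).

Definition flip n (i : 'I_n) (s : n.-tuple bool) : n.-tuple bool :=
  [tuple if j == i then ~~ tnth s j else tnth s j | j < n].

Lemma flipK n (i : 'I_n) : involutive (flip i).
Proof.
move=> s; apply: eq_from_tnth => j; rewrite !tnth_mktuple.
by case: eqP => // _; rewrite negbK.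
Qed.

Lemma sum_weight n (p : 'I_n -> R) : \sum_s weight p s = 1.
Proof.
rewrite (sum_tuple_prod (fun i b => (1 + p i * sgb b) / 2)).
by rewrite big1// => i _; rewrite big_bool /=; field.
Qed.

Lemma weight_ge0 n (p : 'I_n -> R) s : (forall i, 0 <= p i <= 1) ->
  0 <= weight p s.
Proof.
move=> p01; apply: prodr_ge0 => i _; have /andP[] := p01 i.
by rewrite /sgb; case: (tnth s i) => *; lra.
Qed.

(** The difference of the two weights is odd under [flip i]. Pairing [s] with [flip i s] therefore
    replaces [f] by half of its increment across coordinate [i], which the sensitivity [c]
    controls. *)
Lemma sum_weight_swap n (p q : 'I_n -> R) (i : 'I_n) (c : R)
    (f : n.-tuple bool -> R) :
  (forall j, 0 <= p j <= 1) -> p i = 0 -> 0 <= q i ->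
  (forall j, j != i -> q j = p j) ->
  (forall s, `|f s - f (flip i s)| <= c) ->
  `|\sum_s (weight q s - weight p s) * f s| <= q i * c / 2.
Proof.
move=> p01 pi0 qi0 qp fc.
(* As [p i = 0], [weight p] is invariant under [flip i]. *)
have diff s : weight q s - weight p s = q i * sgb (tnth s i) * weight p s.
  rewrite /weight (bigD1 i)//= [in RHS](bigD1 i)//= [X in _ - X](bigD1 i)//=.
  rewrite (@eq_bigr _ _ _ _ _ _ _
    (fun j => (1 + p j * sgb (tnth s j)) / 2)) => [|j ji]; last by rewrite qp.
  by rewrite pi0; field.
have wflip s : weight p (flip i s) = weight p s.
  apply: eq_bigr => j _; rewrite tnth_mktuple.
  by case: eqP => // ->; rewrite pi0 !mul0r.
have sflip s : sgb (tnth (flip i s) i) = - sgb (tnth s i).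
  by rewrite tnth_mktuple eqxx /sgb; case: (tnth s i) => /=; rewrite ?opprK.
have double : 2 * \sum_s (weight q s - weight p s) * f s =
    \sum_s q i * sgb (tnth s i) * weight p s * (f s - f (flip i s)).
  rewrite mulr_natl mulr2n {2}(reindex_inj (inv_inj (@flipK n i))) -big_split.
  by apply: eq_bigr => s _ /=; rewrite !diff sflip wflip; ring.
rewrite ler_pdivlMr ?ltr0n// mulrC -[2 in leLHS]gtr0_norm// -normrM double.
rewrite (le_trans (ler_norm_sum _ _ _))//.
apply: (@le_trans _ _ (\sum_s q i * c * weight p s)); last first.
  by rewrite -mulr_sumr sum_weight mulr1.
apply: ler_sum => s _; rewrite !normrM (ger0_norm qi0).
rewrite (ger0_norm (weight_ge0 _ p01)).
have -> : `|sgb (tnth s i)| = 1.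
  by rewrite /sgb; case: ifP => _; rewrite ?normrN normr1.
by rewrite mulr1 mulrAC ler_wpM2r ?weight_ge0// ler_wpM2l.
Qed.

Definition hybrid (n : nat) (d : R) (k : nat) (i : 'I_n) : R :=
  if (i < k)%N then d else 0.

Lemma hybrid01 n d k (i : 'I_n) : 0 <= d <= 1 -> 0 <= hybrid d k i <= 1.
Proof. by rewrite /hybrid => d01; case: ifP => // _; rewrite lexx ler01. Qed.

Lemma hybrid0 n d : @hybrid n d 0 = fun=> 0.
Proof. by []. Qed.

Lemma hybridT n d : @hybrid n d n = fun=> d.
Proof. by apply/funext => i; rewrite /hybrid ltn_ord. Qed.

(** Telescoping: passing from [hybrid d k] to [hybrid d k.+1] biases coordinate [k] alone, which
    costs one use of [sum_weight_swap]. Privacy will supply [c]. *)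
Lemma sum_hybrid_prefix n (d : R) (c : 'I_n -> R) k (f : n.-tuple bool -> R) :
  0 <= d <= 1 -> (k <= n)%N ->
  (forall i s, `|f s - f (flip i s)| <= c i) ->
  `|\sum_s (weight (hybrid d k) s - weight (hybrid d 0) s) * f s|
    <= \sum_(i < n | (i < k)%N) d * c i / 2.
Proof.
move=> d01 + fc; have /andP[d0 _] := d01; elim: k => [_|k IHk kn].
  rewrite !big1 ?normr0// => s _; by rewrite subrr mul0r.
have -> : \sum_s (weight (hybrid d k.+1) s - weight (hybrid d 0) s) * f s =
    \sum_s (weight (hybrid d k.+1) s - weight (hybrid d k) s) * f s +
    \sum_s (weight (hybrid d k) s - weight (hybrid d 0) s) * f s.
  by rewrite -big_split; apply: eq_bigr => s _ /=; ring.
rewrite (bigD1 (Ordinal kn))//= (le_trans (ler_normD _ _))// lerD//.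
  have dk : hybrid d k.+1 (Ordinal kn) = d by rewrite /hybrid /= ltnSn.
  rewrite -[X in X * c _]dk; apply: sum_weight_swap => //.
  - by move=> j; exact: hybrid01.
  - by rewrite /hybrid /= ltnn.
  - by rewrite dk.
  - move=> j jk; rewrite /hybrid ltnS leq_eqVlt.
    by rewrite (_ : (j == k :> nat) = false)//; apply: contra_neqF jk => /eqP jk; exact/val_inj.
rewrite (le_trans (IHk (ltnW kn)))// le_eqVlt; apply/orP; left; apply/eqP.
apply: eq_bigl => j; rewrite ltnS (ltn_neqAle j k) andbC.
by congr (_ && ~~ _); apply/eqP/eqP => [jk|->//]; exact/val_inj.
Qed.

(** The last [n - k] coordinates are biased all at once: the second moment of the likelihood ratio
    factorizes, each coordinate contributing [1 + d ^ 2]. *)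
Lemma sum_hybrid_suffix n (d : R) k (f : n.-tuple bool -> R) :
  0 <= d <= 1 -> (k <= n)%N -> (forall s, 0 <= f s <= 1) ->
  `|\sum_s (weight (hybrid d n) s - weight (hybrid d k) s) * f s|
    <= (1 + d ^+ 2) ^+ (n - k) - 1 + 4^-1.
Proof.
move=> d01 kn f01.
(* [L] is the likelihood ratio; [|L - 1| <= (L - 1) ^ 2 + 1 / 4] bounds the
   total variation distance by the chi-square divergence. *)
pose L (s : n.-tuple bool) :=
  \prod_(i < n) (if (i < k)%N then 1 else 1 + d * sgb (tnth s i)).
have wL s : weight (hybrid d n) s = weight (hybrid d k) s * L s.
  rewrite -big_split; apply: eq_bigr => i _ /=.
  by rewrite /hybrid ltn_ord; case: ifP => _; field.
have wL2 : \sum_s weight (hybrid d k) s * L s ^+ 2 = (1 + d ^+ 2) ^+ (n - k).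
  under eq_bigr do rewrite expr2 -!big_split.
  rewrite (sum_tuple_prod (fun (i : 'I_n) b =>
    ((1 + hybrid d k i * sgb b) / 2 *
     ((if (i < k)%N then 1 else 1 + d * sgb b) *
      (if (i < k)%N then 1 else 1 + d * sgb b))))).
  transitivity (\prod_(i < n) (if (i < k)%N then 1 else 1 + d ^+ 2)).
    by apply: eq_bigr => i _; rewrite big_bool /hybrid /=; case: ifP => _; field.
  rewrite (bigID (fun i : 'I_n => (i < k)%N)) /= big1 ?mul1r => [|i ->//].
  rewrite (eq_bigr (fun=> 1 + d ^+ 2)) => [|i /negbTE->//].
  by rewrite prodr_const card_ord_ge.
have w0 (s : n.-tuple bool) : 0 <= weight (hybrid d k) s.
  by apply: weight_ge0 => i; exact: hybrid01.
(* The right-hand side is [(L s - 1) ^ 2 + 1 / 4] times the weight, expanded so that every term has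
   a known sum. *)
have bound (s : n.-tuple bool) : `|(weight (hybrid d n) s - weight (hybrid d k) s) * f s| <=
    weight (hybrid d k) s * L s ^+ 2 - 2 * weight (hybrid d n) s +
    (1 + 4^-1) * weight (hybrid d k) s.
  rewrite wL (_ : _ * _ - _ = weight (hybrid d k) s * (L s - 1)); last by ring.
  rewrite 2!normrM (ger0_norm (w0 s)).
  apply: (@le_trans _ _ (weight (hybrid d k) s * `|L s - 1|)).
    rewrite ler_piMr ?mulr_ge0//; have /andP[? ?] := f01 s.
    by rewrite ger0_norm.
  rewrite [leRHS](_ : _ = weight (hybrid d k) s * ((L s - 1) ^+ 2 + 4^-1)); last first.
    by ring.
  rewrite ler_wpM2l// -(real_normK (num_real (L s - 1))).
  by set u := `|_|; have := sqr_ge0 (u - 2^-1); nra.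
rewrite (le_trans (ler_norm_sum _ _ _))// (le_trans (ler_sum _ (fun s _ => bound s)))//.
rewrite big_split sumrB -!mulr_sumr wL2 !sum_weight /=; lra.
Qed.

(** From [1 - x / 2 <= exp (- x / 2)] one gets [exp x <= (1 - x / 2) ^ -2]. Halving the exponent
    first keeps the denominator away from 0 on the whole interval, unlike [1 / (1 - x)]. *)
Lemma expR_le1D3x (x : R) : 0 <= x <= 1 -> expR x <= 1 + 3 * x.
Proof.
move=> /andP[x0 x1].
have h : 1 - x / 2 <= expR (- (x / 2)) by rewrite expR_ge1Dx.
have -> : expR x = (expR (- (x / 2)) ^+ 2)^-1.
  by rewrite -expRM_natl -expRN; congr expR; field.
rewrite -[leRHS]invrK lef_pV2 ?posrE ?exprn_gt0 ?expR_gt0 ?invr_gt0//; last lra.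
apply: (@le_trans _ _ ((1 - x / 2) ^+ 2)).
  rewrite -div1r ler_pdivrMr; last lra.
  rewrite -subr_ge0 (_ : _ - _ = x * (1 - x) * (2 - 3 / 4 * x)); last by field.
  by rewrite !mulr_ge0//; lra.
by rewrite lerXn2r ?nnegrE ?expR_ge0//; lra.
Qed.

End sign_weights.

(** * Samples from two-point laws as finite sums over sign vectors *)

Section two_point_laws.
Context {R : realType}.
Local Notation mR := (measurableTypeR R).

Definition half_sign (b : bool) : mR := (sgb R b / 2)%R.

Lemma measurable_half_sign : measurable_fun [set: bool] half_sign.
Proof. by []. Qed.

HB.instance Definition _ :=
  isMeasurableFun.Build _ _ _ _ half_sign measurable_half_sign.

Definition two_point (d : R) : probability mR R :=
  distribution (bernoulli_prob ((1 + d) / 2)%R) half_sign.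

Lemma integral_two_point (d : R) (f : mR -> \bar R) : (0 <= d <= 1)%R ->
  measurable_fun [set: mR] f -> (forall x, 0 <= f x) ->
  \int[two_point d]_x f x =
  \sum_b ((1 + d * sgb R b) / 2)%:E * f (half_sign b).
Proof.
move=> /andP[d0 d1] mf f0; rewrite ge0_integral_distribution//.
rewrite integral_bernoulli_prob//=; last lra.
rewrite big_bool /=; congr (_%:E * _ + _%:E * _); rewrite ?mulr1//.
by rewrite /onem; field.
Qed.

Lemma integral_iid_two_point n (d : R) (f : n.-tuple mR -> \bar R) :
  (0 <= d <= 1)%R -> measurable_fun [set: n.-tuple mR] f ->
  (forall x, 0 <= f x) ->
  \int[iid_law (two_point d) n]_x f x =
  \sum_(s : n.-tuple bool) (weight (fun=> d) s)%:E * f (map_tuple half_sign s).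
Proof.
move=> d01; elim: n f => [|n IHn] f mf f0.
  rewrite /= integral_dirac// diracT mul1e (big_pred1 [tuple]) => [|s]; last first.
    by rewrite (tuple0 s) /= eqxx.
  by rewrite /weight big_ord0 mul1e; congr f; exact/val_inj.
rewrite integral_iid_lawS//.
have mft x : measurable_fun [set: n.-tuple mR] (fun t => f [tuple of x :: t]).
  by apply: (measurableT_comp mf); exact: measurable_cons.
under eq_integral do rewrite IHn//.
rewrite sum_tuple_cons integral_two_point//; last 2 first.
- apply: emeasurable_sum => s; apply: emeasurable_funM => //.
  by apply: (measurableT_comp mf); exact: measurable_cons.
- move=> x; apply: sume_ge0 => s _; apply: mule_ge0 => //.
  by rewrite lee_fin weight_ge0.
apply: eq_bigr => b _; rewrite ge0_sume_distrr => [|s _]; last first.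
  by rewrite mule_ge0// lee_fin weight_ge0.
apply: eq_bigr => s _; rewrite muleA -EFinM; congr (_%:E * f _).
  rewrite /weight big_ord_recl tnth0; congr (_ * _)%R.
  by apply: eq_bigr => i _; rewrite tnthS.
exact/val_inj.
Qed.

Lemma two_point_bounded (d : R) : bounded_laws (two_point d).
Proof.
rewrite /bounded_laws /= /distribution /pushforward.
rewrite (_ : _ @^-1` _ = setT) ?probability_setT//.
apply/seteqP; split => // b _ /=.
by rewrite /half_sign /sgb; case: b; rewrite ?mulN1r ?normrN ?mul1r ger0_norm// invr_ge0.
Qed.

Lemma mean_two_point (d : R) : (0 <= d <= 1)%R -> mean (two_point d) = (d / 2)%R.
Proof.
move=> d01; rewrite /mean unlock integralE.
have mE : measurable_fun [set: mR] (@EFin R) by exact: EFin_measurable.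
rewrite !integral_two_point//; last 2 first.
- exact: measurable_funeneg.
- exact: measurable_funepos.
rewrite !big_bool /= !funeposE !funenegE /half_sign /sgb !mul1r !mulr1 mulN1r.
rewrite -!EFinN opprK.
have h0 : (0 <= 2^-1 :> R)%R by rewrite invr_ge0.
have h0' : (- 2^-1 <= 0 :> R)%R by rewrite oppr_le0.
rewrite (max_idPl _) ?lee_fin// (max_idPr _) ?lee_fin//.
by rewrite !mule0 adde0 add0e -!EFinM /=; field.
Qed.

End two_point_laws.

(** * Le Cam's two-point argument under privacy *)

Section le_cam.
Context {R : realType}.
Local Notation mR := (measurableTypeR R).

Lemma integral_sq_ge (mu : {measure set mR -> \bar R}) (c t : R) (E : set mR) :
  measurable E -> (0 <= t)%R -> (forall y, E y -> (t <= `|y - c|)%R) ->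
  (t ^+ 2)%:E * mu E <= \int[mu]_y ((`|y - c| ^+ 2)%R)%:E.
Proof.
move=> mE t0 tE.
have mf : measurable_fun [set: mR] (fun y : mR => ((`|y - c| ^+ 2)%R)%:E).
  apply/measurable_EFinP/measurable_funX/measurableT_comp => //.
  exact: measurable_funB.
rewrite -integral_cst//; apply: (@le_trans _ _ (\int[mu]_(y in E) ((`|y - c| ^+ 2)%R)%:E)).
  apply: ge0_le_integral => //.
  - by move=> y _; rewrite lee_fin sqr_ge0.
  - exact: measurable_funTS.
  - move=> y Ey; rewrite lee_fin lerXn2r ?nnegrE//; exact: tE.
apply: ge0_subset_integral => //.
Qed.

(** Markov's inequality on each dataset, averaged over the samples: an event on which the output
    misses the mean by [t] costs [t ^ 2] times its probability. *)
Lemma two_point_mse_ge n (A : estimator n) (d t : R) (E : set mR) :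
  (0 <= d <= 1)%R -> (0 <= t)%R -> measurable E ->
  (forall y, E y -> (t <= `|y - d / 2|)%R) ->
  (t ^+ 2 * \sum_s weight (fun=> d) s * fine (A (map_tuple half_sign s) E))%:E
    <= mean_squared_error mean A (two_point d).
Proof.
move=> d01 t0 mE tE; rewrite /mean_squared_error mean_two_point//.
have mf : measurable_fun [set: mR] (fun y : mR => ((`|y - d / 2| ^+ 2)%R)%:E).
  apply/measurable_EFinP/measurable_funX/measurableT_comp => //.
  exact: measurable_funB.
rewrite integral_iid_two_point//; last 2 first.
- apply: (measurable_fun_integral_kernel (l := A)) => //.
  by move=> U mU; exact: measurable_kernel.
- by move=> x; apply: integral_ge0 => y _; rewrite lee_fin.
rewrite mulr_sumr -sumEFin; apply: lee_sum => s _.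
rewrite mulrCA EFinM; apply: lee_wpmul2l; first by rewrite lee_fin weight_ge0.
rewrite EFinM fineK; first exact: integral_sq_ge.
exact: finite_kernel_measure.
Qed.

Lemma datasets_half_sign n (s : n.-tuple bool) :
  @datasets R n (map_tuple half_sign s).
Proof.
move=> i; rewrite tnth_map /data_space /= in_itv /= /half_sign /sgb.
by case: (tnth s i); lra.
Qed.

(** Privacy bounds a ratio of probabilities. Since these are at most 1, their difference is at most
    [exp (eps i) - 1]; using privacy in both directions gives the absolute value. *)
Lemma dp_flip n (eps : 'I_n -> R) (A : estimator n) (i : 'I_n) (W : set mR)
    (s : n.-tuple bool) :
  central_dp eps A -> (0 <= eps i <= 1)%R -> measurable W ->
  (`|fine (A (map_tuple half_sign s) W) -
     fine (A (map_tuple half_sign (flip i s)) W)| <= 3 * eps i)%R.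
Proof.
move=> dpA e01 mW; have e3 := expR_le1D3x e01.
have eq_off j : j != i -> tnth (map_tuple half_sign s) j =
    tnth (map_tuple (@half_sign R) (flip i s)) j.
  by move=> /negbTE ji; rewrite !tnth_map tnth_ord_tuple ji.
have dp1 := dpA i _ _ (datasets_half_sign s) (datasets_half_sign (flip i s)) eq_off W mW.
have dp2 := dpA i _ _ (datasets_half_sign (flip i s)) (datasets_half_sign s)
  (fun j ji => esym (eq_off j ji)) W mW.
have fin x : A x W \is a fin_num by exact: finite_kernel_measure.
have le1 x : (fine (A x W) <= 1)%R.
  rewrite -lee_fin fineK// -(prob_kernel (s := A) x).
  by rewrite le_measure ?inE.
have ge0 x : (0 <= fine (A x W))%R by rewrite fine_ge0.
move: dp1 dp2; rewrite -(fineK (fin (map_tuple half_sign s))).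
rewrite -(fineK (fin (map_tuple half_sign (flip i s)))) -!EFinM !lee_fin => dp1 dp2.
have e0 : (0 <= expR (eps i) - 1)%R.
  by rewrite subr_ge0 -expR0 ler_expR; case/andP: e01.
have gap (p q : R) : (p <= expR (eps i) * q -> q <= 1 -> p - q <= 3 * eps i)%R.
  move=> pq q1; have : ((expR (eps i) - 1) * q <= expR (eps i) - 1)%R.
    by rewrite ler_piMr.
  lra.
by rewrite ler_norml lerNl opprB; apply/andP; split; apply: gap => //; exact: le1.
Qed.

Lemma minimax_error_ge n (eps : 'I_n -> R) (k : nat) :
  (forall i, 0 <= eps i <= 1)%R -> (k <= n)%N ->
  ((2048 * Num.max (effective_size eps k) 1)^-1)%:E
    <= minimax_error bounded_laws mean eps.
Proof.
move=> e01 kn; apply: le_ereal_inf_tmp => _ [A dpA <-].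
set M := Num.max _ _; set S := (\sum_(i < n | (i < k)%N) eps i)%R.
have M1 : (1 <= M)%R by rewrite le_max lexx orbT.
have MN : ((n - k)%:R + S ^+ 2 <= M)%R by rewrite le_max lexx.
have S0 : (0 <= S)%R by apply: sumr_ge0 => i _; case/andP: (e01 i).
have r0 : (0 < Num.sqrt M)%R by rewrite sqrtr_gt0; lra.
have r2 : (Num.sqrt M ^+ 2 = M)%R by rewrite sqr_sqrtr//; lra.
(* Chosen so that [d ^ 2 * M = 1 / 16]. As [M] dominates 1, [S ^ 2] and [n - k], this gives
   [d <= 1 / 4], [d * S <= 1 / 4] and [(n - k) * d ^ 2 <= 1 / 16]. *)
pose d : R := ((4 * Num.sqrt M)^-1)%R.
have d0 : (0 < d)%R by rewrite invr_gt0; lra.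
have d2 : (d ^+ 2 * M = 16^-1)%R.
  by rewrite -r2 /d; field; rewrite gt_eqF.
have sq4 (u : R) : (0 <= u -> u ^+ 2 <= 16^-1 -> u <= 4^-1)%R.
  move=> u0; rewrite (_ : 16^-1 = 4^-1 ^+ 2)%R; last by field.
  by rewrite ler_pXn2r ?nnegrE ?invr_ge0.
have d1 : (d <= 1)%R.
  apply: (@le_trans _ _ 4^-1%R); last by rewrite invf_le1 ?ler1n.
  by rewrite sq4 ?(ltW d0)// -d2 ler_peMr ?sqr_ge0.
have dS : (d * S <= 4^-1)%R.
  rewrite sq4 ?mulr_ge0 ?(ltW d0)// -d2 exprMn ler_wpM2l ?sqr_ge0//.
  by rewrite (le_trans _ MN)// lerDr.
have d01 : (0 <= d <= 1)%R by rewrite ltW.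
(* Bound the power by [exp ((n - k) * d ^ 2)], then use [exp u <= 1 / (1 - u)] with
   [u <= 1 / 16]. *)
have dnk : ((1 + d ^+ 2) ^+ (n - k) <= 16 / 15)%R.
  have h1 : ((n - k)%:R * d ^+ 2 <= 16^-1)%R.
    rewrite mulrC -d2 ler_wpM2l ?sqr_ge0// (le_trans _ MN)// lerDl sqr_ge0//.
  apply: (@le_trans _ _ (expR (d ^+ 2) ^+ (n - k))%R).
    by rewrite lerXn2r ?nnegrE ?expR_ge0 ?expR_ge1Dx// addr_ge0 ?sqr_ge0.
  rewrite -expRM_natl -[leRHS]invrK -[leLHS]invrK lef_pV2 ?posrE ?invr_gt0 ?expR_gt0//.
  rewrite -expRN; apply: (@le_trans _ _ (1 - (n - k)%:R * d ^+ 2)%R); last exact: expR_ge1Dx.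
  lra.
(* The test threshold [d / 4] is midway between the means 0 and [d / 2]; on either side the output
   is at least [d / 4] away from one of them. *)
pose W : set mR := [set y | (d / 4 <= y)%R].
have mW : measurable W by rewrite /W -set_itvcy; exact: measurable_itv.
pose f (s : n.-tuple bool) := fine (A (map_tuple half_sign s) W).
have fin x V : measurable V -> A x V \is a fin_num.
  by move=> mV; exact: finite_kernel_measure.
have f01 s : (0 <= f s <= 1)%R.
  rewrite fine_ge0//= -lee_fin fineK ?fin// -(prob_kernel (s := A) (map_tuple half_sign s)).
  by rewrite le_measure ?inE.
have fC s : fine (A (map_tuple half_sign s) (~` W)) = (1 - f s)%R.
  have := prob_kernel (s := A) (map_tuple half_sign s).
  rewrite -(setUv W) measureU ?setICr//; last exact: measurableC.
  move=> /(congr1 fine); rewrite fineD; last 2 first.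
  - exact: fin.
  - exact/fin/measurableC.
  by rewrite -/(f s) /= => <-; ring.
(* The private prefix contributes at most [3 / 2 * d * S <= 3 / 8], the suffix at most
   [1 / 15 + 1 / 4]; the total is below [3 / 4]. *)
have tv : (\sum_s weight (fun=> d) s * f s - \sum_s weight (fun=> 0) s * f s <= 3 / 4)%R.
  have := @sum_hybrid_prefix _ n d (fun i => 3 * eps i)%R k f d01 kn
    (fun i s => dp_flip s dpA (e01 i) mW).
  have := sum_hybrid_suffix d01 kn f01.
  rewrite hybrid0 hybridT => /(le_trans (ler_norm _)) h1 /(le_trans (ler_norm _)) h2.
  have -> : (\sum_s weight (fun=> d) s * f s - \sum_s weight (fun=> 0) s * f s =
     \sum_s (weight (fun=> d) s - weight (hybrid d k) s) * f s +
     \sum_s (weight (hybrid d k) s - weight (fun=> 0) s) * f s)%R.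
    by rewrite -sumrB -big_split; apply: eq_bigr => s _ /=; ring.
  have h3 : (\sum_(i < n | (i < k)%N) d * (3 * eps i) / 2 = 3 / 2 * (d * S))%R.
    by rewrite !mulr_sumr; apply: eq_bigr => i _; field.
  by move: h1 h2; rewrite h3; lra.
have z01 : (0 <= (0 : R) <= 1)%R by rewrite lexx ler01.
have t0 : (0 <= d / 4)%R by rewrite divr_ge0// ltW.
have m0 := @two_point_mse_ge n A 0 (d / 4) W z01 t0 mW.
have m1 := @two_point_mse_ge n A d (d / 4) (~` W) d01 t0 (measurableC mW).
have {}m0 : ((d / 4) ^+ 2 * \sum_s weight (fun=> 0) s * f s)%:E
    <= mean_squared_error mean A (two_point 0).
  apply: m0 => y; rewrite /W /= mul0r subr0 => /le_trans; apply; exact: ler_norm.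
have {}m1 : ((d / 4) ^+ 2 * (1 - \sum_s weight (fun=> d) s * f s))%:E
    <= mean_squared_error mean A (two_point d).
  have -> : (1 - \sum_s weight (fun=> d) s * f s =
      \sum_s weight (fun=> d) s * fine (A (map_tuple half_sign s) (~` W)))%R.
    rewrite -[X in (X - _)%R](@sum_weight R n (fun=> d)) -sumrB.
    by apply: eq_bigr => s _; rewrite fC; ring.
  apply: m1 => y /negP; rewrite -ltNge => yd.
  by rewrite -normrN (le_trans _ (ler_norm _))//; lra.
have supP e : mean_squared_error mean A (two_point e) <=
    ereal_sup [set mean_squared_error mean A P | P in bounded_laws].
  by apply: ereal_sup_ubound; exists (two_point e) => //; exact: two_point_bounded.
have goal : ((2048 * M)^-1 = (d / 4) ^+ 2 / 8)%R.
  by rewrite -r2 /d; field; rewrite gt_eqF.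
(* Either [W] has probability at least [1 / 8] under mean 0, or by [tv] it has probability below
   [1 / 8 + 3 / 4] under mean [d / 2], so its complement has more than [1 / 8] there. The error is
   at least [(d / 4) ^ 2 / 8] in both cases. *)
have [le8|gt8] := leP (8^-1)%R (\sum_s weight (fun=> 0) s * f s)%R.
- apply: le_trans (supP 0%R); apply: le_trans m0.
  by rewrite lee_fin goal ler_wpM2l// sqr_ge0.
- apply: le_trans (supP d); apply: le_trans m1.
  by rewrite lee_fin goal ler_wpM2l ?sqr_ge0//; lra.
Qed.

End le_cam.

(** * Laplace noise *)

Section integral_density.
Context d (T : measurableType d) (R : realType).
Import HBNNSimple.

(** Approximate [f] from below by simple functions: monotone convergence on both sides reduces the
    claim to indicators, where it is the hypothesis on [nu]. *)
Lemma ge0_integral_density (mu nu : {measure set T -> \bar R}) (g : T -> R)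
    (f : T -> \bar R) :
  measurable_fun [set: T] g -> (forall x, 0 <= g x)%R ->
  (forall A, measurable A -> nu A = \int[mu]_(x in A) (g x)%:E) ->
  measurable_fun [set: T] f -> (forall x, 0 <= f x) ->
  \int[nu]_x f x = \int[mu]_x (f x * (g x)%:E).
Proof.
move=> mg g0 nuE mf f0.
have mgE : measurable_fun [set: T] (fun x => (g x)%:E) by exact/measurable_EFinP.
pose h := nnsfun_approx measurableT mf.
have hf x : (h n x)%:E @[n --> \oo] --> f x by exact: cvg_nnsfun_approx.
have hnd x : {homo (fun n => h n x) : a b / (a <= b)%N >-> (a <= b)%R}.
  by move=> a b ab; exact/lefP/nd_nnsfun_approx.
have -> : \int[nu]_x f x = limn (fun n => \int[nu]_x (h n x)%:E).
  rewrite -monotone_convergence//.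
  - by apply: eq_integral => x _; exact/esym/cvg_lim.
  - by move=> n; exact/measurable_EFinP.
  - by move=> n x _; rewrite lee_fin.
  - by move=> x _ a b ab; rewrite lee_fin hnd.
have -> : \int[mu]_x (f x * (g x)%:E) =
    limn (fun n => \int[mu]_x ((h n x)%:E * (g x)%:E)).
  rewrite -monotone_convergence//.
  - apply: eq_integral => x _; apply/esym/cvg_lim => //.
    by apply: cvgeZr => //; exact: hf.
  - by move=> n; apply: emeasurable_funM => //; exact/measurable_EFinP.
  - by move=> n x _; rewrite mule_ge0// lee_fin.
  - by move=> x _ a b ab; rewrite lee_wpmul2r// lee_fin// hnd.
congr (limn _); apply/funext => n.
transitivity (\int[nu]_x (\sum_(y \in range (h n))
    (y * \1_(h n @^-1` [set y]) x)%:E)).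
  by apply: eq_integral => t _; rewrite fimfunE -fsumEFin.
have mind r : measurable_fun [set: T] (fun x => (r * \1_(h n @^-1` [set r]) x)%:E).
  exact/measurable_EFinP/measurable_funM.
rewrite ge0_integral_fsum//; last by move=> m y _; exact: nnfun_muleindic_ge0.
transitivity (\int[mu]_x (\sum_(y \in range (h n))
    (y * \1_(h n @^-1` [set y]) x)%:E * (g x)%:E)); last first.
  apply: eq_integral => x _; rewrite -ge0_mule_fsuml => [|y]; last first.
    exact: nnfun_muleindic_ge0.
  by rewrite fsumEFin// -(fimfunE _ x).
rewrite ge0_integral_fsum//; last 2 first.
- by move=> y; exact: emeasurable_funM.
- by move=> m y _; rewrite mule_ge0 ?lee_fin// -lee_fin nnfun_muleindic_ge0.
apply: eq_fsbigr => r /[!inE] -[t _ rt].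
have r0 : (0 <= r)%R by rewrite -rt.
have mr : measurable (h n @^-1` [set r]) by exact: measurable_funPTI.
rewrite integralZl_indic_nnsfun// integral_indic// setIT nuE//.
under [RHS]eq_integral do rewrite EFinM -muleA.
rewrite ge0_integralZl_EFin//; last 2 first.
- by move=> x _; rewrite mule_ge0// lee_fin.
- by apply: emeasurable_funM => //; exact/measurable_EFinP.
congr (_ * _); rewrite [LHS]integral_mkcond; apply: eq_integral => x _.
by rewrite patchE indicE; case: ifPn => _; rewrite ?mul1e ?mul0e.
Qed.

End integral_density.

(** * Translation invariance of Lebesgue measure *)

Section translation.
Context {R : realType}.
Local Notation mR := (measurableTypeR R).

Definition translate (c : R) (x : mR) : mR := (c + x)%R.

Lemma measurable_translate c : measurable_fun [set: mR] (translate c).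
Proof. exact: measurable_funD. Qed.

HB.instance Definition _ c :=
  isMeasurableFun.Build _ _ _ _ (translate c) (measurable_translate c).

(** Lebesgue measure is determined by its values on half-open intervals, whose length a translation
    preserves. *)
Lemma lebesgue_measure_translate (c : R) (A : set mR) : measurable A ->
  pushforward lebesgue_measure (translate c) A = lebesgue_measure A.
Proof.
move=> mA; apply/esym/lebesgue_measure_unique => //= _ [[a b]] _ <-.
rewrite /pushforward (_ : _ @^-1` _ = `](a - c)%R, (b - c)%R]%classic).
  rewrite !lebesgue_measure_itv/= !lte_fin ltrD2r; case: ifP => // _.
  by rewrite -!EFinB; congr _%:E; ring.
apply/seteqP; split => x /=; rewrite /translate !in_itv/= ltrBlDr lerBrDr.
  by rewrite addrC.
by rewrite addrC.
Qed.

Lemma ge0_integral_translate (c : R) (W : set mR) (f : mR -> \bar R) :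
  measurable W -> measurable_fun [set: mR] f -> (forall x, 0 <= f x) ->
  \int[lebesgue_measure]_(x in W) f x =
  \int[lebesgue_measure]_(x in translate c @^-1` W) f (c + x)%R.
Proof.
move=> mW mf f0.
rewrite -(ge0_integral_pushforward (measurable_translate c))//.
- by apply: eq_measure_integral => A mA _; exact/esym/lebesgue_measure_translate.
- exact: measurable_funTS.
Qed.

End translation.

(** * The Laplace distribution: total mass and second moment *)

Section laplace.
Context {R : realType}.
Local Notation mR := (measurableTypeR R).

Lemma laplace_pdf_ge0 (b z : R) : (0 < b)%R -> (0 <= laplace_pdf b z)%R.
Proof. by move=> b0; rewrite mulr_ge0 ?expR_ge0// invr_ge0; lra. Qed.

Lemma continuous_laplace_pdf (b : R) : continuous (laplace_pdf b).
Proof.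
move=> z.
apply: (@continuousM _ R^o (fun=> ((2 * b)^-1)%R) (fun z => expR (- `|z| / b))).
  exact: cst_continuous.
apply: continuous_comp; last exact: continuous_expR.
apply: (@continuousM _ R^o (fun z : R => (- `|z|)%R) (fun=> (b^-1)%R)).
  by apply: (@continuousN _ R^o); exact: norm_continuous.
exact: cst_continuous.
Qed.

Lemma measurable_laplace_pdf (b : R) : measurable_fun [set: mR] (laplace_pdf b).
Proof. exact: continuous_measurable_fun (@continuous_laplace_pdf b). Qed.

(** By symmetry the integral is twice the one over the half-line, where twice the density is the
    exponential density of rate [1 / b]. *)
Lemma integral_laplace_pdf (b : R) : (0 < b)%R ->
  \int[lebesgue_measure]_(z in [set: mR]) (laplace_pdf b z)%:E = 1.
Proof.
move=> b0; have bV0 : (0 < b^-1)%R by rewrite invr_gt0.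
rewrite ge0_symfun_integralT; last 3 first.
- by move=> z; exact: laplace_pdf_ge0.
- exact: continuous_laplace_pdf.
- by move=> z /=; rewrite /laplace_pdf normrN.
transitivity (\int[lebesgue_measure]_z (exponential_pdf b^-1 z)%:E); last first.
  exact: integral_exponential_pdf.
rewrite -ge0_integralZl_EFin//; last 3 first.
- by rewrite -set_itvcy.
- by move=> z _; rewrite lee_fin laplace_pdf_ge0.
- apply/measurable_EFinP/measurable_funTS; exact: measurable_laplace_pdf.
rewrite integral_mkcond; apply: eq_integral => z _.
rewrite patchE /=; case: ifPn => [|]; rewrite ?inE/= ?notin_setE/= => z0.
  rewrite exponential_pdfE// /laplace_pdf -EFinM; congr _%:E.
  rewrite ger0_norm// mulrA invfM mulrA divff// mul1r.
  by congr (_ * expR _)%R; rewrite mulNr mulrC mulNr.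
by rewrite lt0_exponential_pdf// ltNge; apply/negP.
Qed.

Section laplace_probability.
Variable b : {posnum R}.

Let laplace0 : laplace_law b%:num set0 = 0.
Proof. by rewrite /laplace_law integral_set0. Qed.

Let laplace_ge0 A : 0 <= laplace_law b%:num A.
Proof. by apply: integral_ge0 => z _; rewrite lee_fin laplace_pdf_ge0. Qed.

Let laplace_sigma_additive : semi_sigma_additive (laplace_law b%:num).
Proof.
move=> /= F mF tF mUF; rewrite /laplace_law ge0_integral_bigcup//; last 2 first.
- by apply/measurable_EFinP/measurable_funTS; exact: measurable_laplace_pdf.
- by move=> z _; rewrite lee_fin laplace_pdf_ge0.
apply: is_cvg_ereal_nneg_natsum_cond => n _ _.
by apply: integral_ge0 => z _; rewrite lee_fin laplace_pdf_ge0.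
Qed.

HB.instance Definition _ := isMeasure.Build _ _ _
  (laplace_law b%:num : set mR -> _) laplace0 laplace_ge0 laplace_sigma_additive.

Let laplace_setT : laplace_law b%:num [set: mR] = 1.
Proof. exact: integral_laplace_pdf. Qed.

HB.instance Definition _ :=
  Measure_isProbability.Build _ _ R (laplace_law b%:num : set mR -> _) laplace_setT.

End laplace_probability.

(** The positivity that makes [laplace_law] a probability is carried by the type of [b], where
    instance inference can find it. *)
Definition laplace_prob (b : {posnum R}) : probability mR R := laplace_law b%:num.

(* [z ^+ 2 <= 16 b ^+ 2 exp (|z| / 2b)], so that up to a constant the second
   moment is dominated by the total mass of the law of scale [2b]. *)
Lemma laplace_second_moment (b : {posnum R}) :
  \int[laplace_prob b]_z ((z : R) ^+ 2)%:E <= (32 * b%:num ^+ 2)%:E.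
Proof.
have b0 : (0 < b%:num)%R by [].
have b20 : (0 < 2 * b%:num)%R by lra.
rewrite (ge0_integral_density (mu := lebesgue_measure) (g := laplace_pdf b%:num))//;
  last 4 first.
- exact: measurable_laplace_pdf.
- by move=> z; exact: laplace_pdf_ge0.
- by apply/measurable_EFinP; exact: measurable_funX.
- by move=> z; rewrite lee_fin sqr_ge0.
apply: (@le_trans _ _ (\int[lebesgue_measure]_z
    ((32 * b%:num ^+ 2)%:E * (laplace_pdf (2 * b%:num) z)%:E))); last first.
  rewrite ge0_integralZl_EFin//.
  - by rewrite integral_laplace_pdf// mule1.
  - by move=> z _; rewrite lee_fin laplace_pdf_ge0.
  - by apply/measurable_EFinP; exact: measurable_laplace_pdf.
apply: ge0_le_integral => //.
- by move=> z _; rewrite -EFinM lee_fin mulr_ge0 ?sqr_ge0 ?laplace_pdf_ge0.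
- apply: emeasurable_funM; apply/measurable_EFinP; first exact: measurable_funX.
  exact: measurable_laplace_pdf.
- apply: emeasurable_funM => //; apply/measurable_EFinP.
  exact: measurable_laplace_pdf.
move=> z _; rewrite -!EFinM lee_fin /laplace_pdf.
set a := b%:num in b0 b20 *.
(* In this unit the two exponentials are [exp (- v) ^ 4] and [exp (- v) ^ 2], and the claim reduces
   to [v ^ 2 <= exp v ^ 2]. *)
pose v := (`|z| / (4 * a))%R.
have v0 : (0 <= v)%R by rewrite divr_ge0//; lra.
have az : (z ^+ 2 = 16 * a ^+ 2 * v ^+ 2)%R.
  by rewrite -(real_normK (num_real z)) /v; field; rewrite gt_eqF.
have ev : (v ^+ 2 <= expR v ^+ 2)%R.
  by rewrite lerXn2r ?nnegrE ?expR_ge0// (le_trans _ (expR_ge1Dx _))// lerDr.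
have e1 : expR (- `|z| / a)%R = (expR (- v) ^+ 4)%R.
  by rewrite -expRM_natl; congr expR; rewrite /v; field; rewrite gt_eqF.
have e2 : expR (- `|z| / (2 * a))%R = (expR (- v) ^+ 2)%R.
  by rewrite -expRM_natl; congr expR; rewrite /v; field; rewrite gt_eqF.
rewrite az e1 e2.
have ee : (expR v * expR (- v) = 1)%R by exact: expRxMexpNx_1.
have -> : (16 * a ^+ 2 * v ^+ 2 * ((2 * a)^-1 * expR (- v) ^+ 4) =
    (8 * a * expR (- v) ^+ 4) * v ^+ 2)%R by field; rewrite gt_eqF.
have -> : (32 * a ^+ 2 * ((2 * (2 * a))^-1 * expR (- v) ^+ 2) =
    (8 * a * expR (- v) ^+ 4) * expR v ^+ 2)%R.
  transitivity (8 * a * expR (- v) ^+ 2 * (expR v * expR (- v)) ^+ 2)%R.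
    by rewrite ee; field; rewrite gt_eqF.
  by ring.
by rewrite ler_wpM2l// !mulr_ge0// ?exprn_ge0 ?expR_ge0// ltW.
Qed.

End laplace.

(** * Upper bound *)

Section noisy_linear_estimator.
Context {R : realType} (n : nat).
Local Notation mR := (measurableTypeR R).
Variables (w : 'I_n -> R) (b : {posnum R}).

Definition linear_form (x : n.-tuple mR) : mR := (\sum_(i < n) w i * tnth x i)%R.

Lemma measurable_linear_form : measurable_fun [set: n.-tuple mR] linear_form.
Proof.
apply: measurable_sum => i; apply: measurable_funM => //.
exact: measurable_tnth.
Qed.

Definition noisy_linear (x : n.-tuple mR) : {measure set mR -> \bar R} :=
  distribution (laplace_prob b) (translate (linear_form x)).

Let measurable_noisy_linear (W : set mR) : measurable W ->
  measurable_fun [set: n.-tuple mR] (noisy_linear ^~ W).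
Proof.
move=> mW.
(* The mass given to [W] on input [x] is the Laplace measure of the section at [x] of this set,
   hence measurable in [x]. *)
have mB : measurable [set p : n.-tuple mR * mR | W (linear_form p.1 + p.2)%R].
  rewrite -[X in measurable X]setTI.
  apply: (_ : measurable_fun setT (fun p : n.-tuple mR * mR =>
    (linear_form p.1 + p.2 : mR)%R)) => //.
  apply: measurable_funD => //.
  by apply: (measurableT_comp measurable_linear_form).
rewrite (_ : noisy_linear ^~ W = laplace_prob b \o
    xsection [set p : n.-tuple mR * mR | W (linear_form p.1 + p.2)%R]).
  exact: measurable_fun_xsection.
apply/funext => x /=; rewrite /noisy_linear /distribution /pushforward.
by congr (laplace_prob b _); apply/seteqP; split => z; rewrite /xsection/= inE.
Qed.

HB.instance Definition _ := isKernel.Build _ _ _ _ R noisy_linear measurable_noisy_linear.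

Let noisy_linear_setT x : noisy_linear x [set: mR] = 1.
Proof. exact: probability_setT. Qed.

HB.instance Definition _ := Kernel_isProbability.Build _ _ _ _ R noisy_linear noisy_linear_setT.

Definition linear_mechanism : estimator n := noisy_linear.

Lemma linear_mechanism_linear : (\sum_(i < n) w i = 1)%R ->
  linear_estimator w (b%:num)^-1 linear_mechanism.
Proof.
move=> w1; split => // =>
x W mW; rewrite invrK; exact: erefl.
Qed.

Lemma laplace_pdf_shift (y m m' : R) :
  (laplace_pdf b%:num (y - m) <=
   expR (`|m - m'| / b%:num) * laplace_pdf b%:num (y - m'))%R.
Proof.
rewrite /laplace_pdf mulrCA ler_wpM2l ?invr_ge0//.
rewrite -expRD ler_expR -mulrDl ler_wpM2r ?invr_ge0//.
have := ler_normD (y - m)%R (m - m')%R.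
by rewrite (_ : y - m + (m - m') = y - m')%R; [lra|ring].
Qed.

(** Moves the dataset from the domain of integration into the density, so that two datasets can be
    compared pointwise in [y]. *)
Lemma linear_mechanismE x W : measurable W -> linear_mechanism x W =
  \int[lebesgue_measure]_(y in W) (laplace_pdf b%:num (y - linear_form x))%:E.
Proof.
move=> mW; rewrite -[LHS]/(noisy_linear x W) (ge0_integral_translate (linear_form x))//.
- by apply: eq_integral => z _; rewrite addrAC subrr add0r.
- apply/measurable_EFinP; apply: (measurableT_comp (measurable_laplace_pdf _)).
  exact: measurable_funB.
- by move=> y; rewrite lee_fin laplace_pdf_ge0.
Qed.

(** Entries of [data_space] differ by at most 1, so changing the [i]-th one moves the center by at
    most [|w i|]. By [laplace_pdf_shift] the density then changes by a factor at most
    [exp (eps i)]. *)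
Lemma linear_mechanism_dp (eps : 'I_n -> R) :
  (forall i, `|w i| <= b%:num * eps i)%R -> central_dp eps linear_mechanism.
Proof.
move=> weps i x x' dx dx' xx' W mW.
have mpdf m : measurable_fun W (fun y : mR => (laplace_pdf b%:num (y - m))%:E).
  apply/measurable_EFinP/measurable_funTS.
  apply: (measurableT_comp (measurable_laplace_pdf _)).
  exact: measurable_funB.
rewrite !linear_mechanismE// -ge0_integralZl_EFin//; last first.
  by move=> y _; rewrite lee_fin laplace_pdf_ge0.
apply: ge0_le_integral => //.
- by move=> y _; rewrite lee_fin laplace_pdf_ge0.
- exact: emeasurable_funM.
move=> y _; rewrite -EFinM lee_fin.
apply: (le_trans (laplace_pdf_shift _ _ (linear_form x'))).
rewrite ler_wpM2r ?laplace_pdf_ge0// ler_expR ler_pdivrMr//.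
have -> : (linear_form x - linear_form x' = w i * (tnth x i - tnth x' i))%R.
  rewrite /linear_form -sumrB (bigD1 i)//= big1 ?addr0 ?mulrBr// => j ji.
  by rewrite xx'// subrr.
have d1 : (`|tnth x i - tnth x' i| <= 1)%R.
  have := dx i; have := dx' i; rewrite /data_space /= !in_itv /=.
  by move=> /andP[? ?] /andP[? ?]; rewrite ler_norml; lra.
rewrite normrM (le_trans (ler_wpM2l _ d1))// mulr1 mulrC; exact: weps.
Qed.

(** The inequality [(u + v) ^ 2 <= 2 * u ^ 2 + 2 * v ^ 2] separates the sampling error from the
    noise without a cross term; 64 is twice the constant of [laplace_second_moment]. *)
Lemma linear_mechanism_mse_le (P : probability mR R) :
  \int[iid_law P n]_x (((linear_form x - mean P) ^+ 2)%R)%:E <=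
     (4^-1 * \sum_(i < n) w i ^+ 2)%:E ->
  mean_squared_error mean linear_mechanism P <=
    (2^-1 * \sum_(i < n) w i ^+ 2 + 64 * b%:num ^+ 2)%:E.
Proof.
move=> var; rewrite /mean_squared_error.
set theta := mean P in var *.
have msq c : measurable_fun [set: mR] (fun y : mR => ((y - c) ^+ 2)%:E).
  by apply/measurable_EFinP/measurable_funX; exact: measurable_funB.
have mlin : measurable_fun [set: n.-tuple mR]
    (fun x => ((linear_form x - theta) ^+ 2)%:E).
  apply/measurable_EFinP/measurable_funX; apply: measurable_funB => //.
  exact: measurable_linear_form.
have inner x : \int[linear_mechanism x]_y ((`|y - theta| ^+ 2)%R)%:E <=
    2%:E * ((linear_form x - theta) ^+ 2)%:E + (64 * b%:num ^+ 2)%:E.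
  under eq_integral do rewrite real_normK ?num_real//.
  rewrite ge0_integral_distribution//; last by move=> y; rewrite lee_fin sqr_ge0.
  apply: (@le_trans _ _ (\int[laplace_prob b]_z
      ((2 * (linear_form x - theta) ^+ 2)%:E + 2%:E * ((z : R) ^+ 2)%:E))).
    apply: ge0_le_integral => //.
    - by move=> z _; rewrite lee_fin sqr_ge0.
    - by apply: (measurableT_comp (msq theta)).
    - apply: emeasurable_funD => //; apply: emeasurable_funM => //.
      by apply/measurable_EFinP; exact: measurable_funX.
    - move=> z _; rewrite -EFinM -EFinD lee_fin /translate addrAC -subr_ge0.
      have square (u v : R) : (2 * u ^+ 2 + 2 * v ^+ 2 - (u + v) ^+ 2 =
        (u - v) ^+ 2)%R by ring.
      by rewrite square sqr_ge0.
  rewrite ge0_integralD//; last 3 first.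
  - by move=> z _; rewrite lee_fin mulr_ge0// sqr_ge0.
  - by move=> z _; rewrite -EFinM lee_fin mulr_ge0// sqr_ge0.
  - apply: emeasurable_funM => //.
    by apply/measurable_EFinP; exact: measurable_funX.
  rewrite integral_cst// [X in _ * X + _ <= _](_ : _ = 1); last first.
    exact: probability_setT.
  rewrite mule1 EFinM leeD2l//.
  rewrite ge0_integralZl_EFin//; last 2 first.
  - by move=> z _; rewrite lee_fin sqr_ge0.
  - by apply/measurable_EFinP; exact: measurable_funX.
  apply: (le_trans (lee_wpmul2l _ (laplace_second_moment b))) => //.
  by rewrite -EFinM lee_fin; lra.
apply: (@le_trans _ _ (\int[iid_law P n]_x
    (2%:E * ((linear_form x - theta) ^+ 2)%:E + (64 * b%:num ^+ 2)%:E))).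
  apply: ge0_le_integral => //.
  - by move=> x _; apply: integral_ge0 => y _; rewrite lee_fin sqr_ge0.
  - apply: (measurable_fun_integral_kernel (l := linear_mechanism)).
    + by move=> U mU; exact: measurable_kernel.
    + by move=> y; rewrite lee_fin sqr_ge0.
    + apply/measurable_EFinP/measurable_funX/measurableT_comp => //.
      exact: measurable_funB.
  - by apply: emeasurable_funD => //; exact: emeasurable_funM.
rewrite ge0_integralD//; last 2 first.
- by move=> x _; rewrite -EFinM lee_fin mulr_ge0// sqr_ge0.
- exact: emeasurable_funM.
rewrite integral_cst// [X in _ + _ * X <= _](_ : _ = 1); last first.
  exact: probability_setT.
rewrite mule1 [leRHS]EFinD leeD2r//.
rewrite ge0_integralZl_EFin//; last by move=> x _; rewrite lee_fin sqr_ge0.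
apply: (le_trans (lee_wpmul2l _ var)) => //.
by rewrite -EFinM lee_fin; lra.
Qed.

End noisy_linear_estimator.

(** * Second moment of a weighted sum of centered samples *)

Section sample_mean.
Context {R : realType}.
Local Notation mR := (measurableTypeR R).
Variable P : probability mR R.
Hypothesis bP : bounded_laws P.

(** The bound on a sample holds almost surely only; cutting integrals down to this set of full
    measure makes it pointwise. *)
Let D : set mR := [set x : mR | (`|x| <= 2^-1)%R].

Let mD : measurable D.
Proof.
rewrite (_ : D = `[(- 2^-1)%R, (2^-1)%R]%classic); first exact: measurable_itv.
by apply/seteqP; split => x; rewrite /D /= in_itv/= ler_norml.
Qed.

Let PDC : P (~` D) = 0.
Proof. by rewrite probability_setC// [P D]bP subee. Qed.

Let TDC : [set: mR] `\` ~` D = D.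
Proof. by rewrite setDE setTI setCK. Qed.

Let intD : P.-integrable D (@EFin R).
Proof.
suff: P.-integrable D (EFin \o (fun x : mR => x : R)) by [].
apply: measurable_bounded_integrable => //.
  by rewrite (le_lt_trans (probability_le1 P mD))// ltry.
exists 1%R; split; first exact: num_real.
move=> M M1 x; rewrite /D /= => xD; rewrite (le_trans xD)// ltW// (le_lt_trans _ M1)//.
by rewrite invf_le1// ler1n.
Qed.

Lemma bounded_law_integrable : P.-integrable [set: mR] (@EFin R).
Proof.
have mN : measurable (~` D) by exact: measurableC.
have mE : measurable_fun [set: mR] (@EFin R) by exact: EFin_measurable.
by apply/(negligible_integrable mN measurableT mE PDC); rewrite TDC.
Qed.

Lemma integral_id_bounded_law : \int[P]_(x in D) (x : R)%:E = (mean P)%:E.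
Proof.
rewrite /mean unlock fineK; last first.
  exact: integrable_fin_num bounded_law_integrable.
rewrite (negligible_integral (measurableC mD) measurableT _ PDC) ?TDC//.
exact: bounded_law_integrable.
Qed.

Lemma integral_sq_affine_le (c w : R) :
  \int[P]_x (((c + w * (x - mean P)) ^+ 2)%R)%:E <= (c ^+ 2 + 4^-1 * w ^+ 2)%:E.
Proof.
set theta := mean P.
have mf : measurable_fun [set: mR] (fun x : mR => ((c + w * (x - theta)) ^+ 2)%:E).
  apply/measurable_EFinP/measurable_funX; apply: measurable_funD => //.
  by apply: measurable_funM => //; exact: measurable_funB.
rewrite (ge0_negligible_integral (measurableC mD) measurableT mf _ PDC);
  last by move=> x _; rewrite lee_fin sqr_ge0.
rewrite TDC.
(* On [-1/2, 1/2], [x ^ 2 <= 1 / 4], so the square is at most an affine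
   function of [x]. *)
pose a : R := ((c - w * theta) ^+ 2 + 4^-1 * w ^+ 2)%R.
pose b : R := (2 * (c - w * theta) * w)%R.
have intb : P.-integrable D (fun x : mR => b%:E * (x : R)%:E).
  exact: integrableZl.
have inta : P.-integrable D (cst a%:E).
  exact: finite_measure_integrable_cst.
apply: (@le_trans _ _ (\int[P]_(x in D) (a%:E + b%:E * (x : R)%:E))).
  apply: ge0_le_integral => //.
  - by move=> x _; rewrite lee_fin sqr_ge0.
  - exact: measurable_funTS.
  - by apply: emeasurable_funD => //; exact: (measurable_int P intb).
  move=> x Dx; rewrite -EFinM -EFinD lee_fin -subr_ge0.
  have -> : (a + b * x - (c + w * (x - theta)) ^+ 2 = w ^+ 2 * (4^-1 - x ^+ 2))%R.
    by rewrite /a /b; ring.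
  rewrite mulr_ge0 ?sqr_ge0// subr_ge0 -(real_normK (num_real x)).
  rewrite (_ : 4^-1 = 2^-1 ^+ 2 :> R)%R; last by field.
  by rewrite lerXn2r ?nnegrE ?invr_ge0.
rewrite integralD// integral_cst// [X in _ * X + _ <= _](_ : _ = 1); last exact: bP.
rewrite mule1 integralZl// integral_id_bounded_law.
rewrite -EFinM -EFinD lee_fin -/theta -subr_ge0.
(* The slack reflects that the variance is at most [1 / 4 - theta ^ 2]. *)
have -> : (c ^+ 2 + 4^-1 * w ^+ 2 - (a + b * theta) = (w * theta) ^+ 2)%R.
  by rewrite /a /b; ring.
exact: sqr_ge0.
Qed.

(* The arbitrary offset [c] makes the induction go through nonnegative integrals
   only: no cross term has to be integrated over the product. *)
Lemma integral_iid_sq_le n (w : 'I_n -> R) (c : R) :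
  \int[iid_law P n]_x
     (((c + \sum_(i < n) w i * (tnth x i - mean P)) ^+ 2)%R)%:E <=
  (c ^+ 2 + 4^-1 * \sum_(i < n) w i ^+ 2)%:E.
Proof.
have mf k (v : 'I_k -> R) e : measurable_fun [set: k.-tuple mR]
    (fun x => ((e + \sum_(i < k) v i * (tnth x i - mean P)) ^+ 2)%:E).
  apply/measurable_EFinP/measurable_funX; apply: measurable_funD => //.
  apply: measurable_sum => i; apply: measurable_funM => //.
  by apply: measurable_funB => //; exact: measurable_tnth.
elim: n w c => [|n IHn] w c.
  rewrite /= integral_dirac//; last exact: mf.
  rewrite [X in X * _ <= _](_ : _ = 1); last exact: diracT.
  by rewrite mul1e !big_ord0 addr0 mulr0 addr0.
rewrite integral_iid_lawS//; last by move=> x; rewrite lee_fin sqr_ge0.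
pose S := (4^-1 * \sum_(i < n) w (lift ord0 i) ^+ 2)%R.
have S0 : (0 <= S)%R by rewrite mulr_ge0// sumr_ge0// => i _; exact: sqr_ge0.
have mg : measurable_fun [set: mR]
    (fun x : mR => ((c + w ord0 * (x - mean P)) ^+ 2)%:E).
  apply/measurable_EFinP/measurable_funX; apply: measurable_funD => //.
  by apply: measurable_funM => //; exact: measurable_funB.
apply: (@le_trans _ _ (\int[P]_x
    (((c + w ord0 * (x - mean P)) ^+ 2)%:E + S%:E))).
  apply: ge0_le_integral => //.
  - by move=> x _; apply: integral_ge0 => t _; rewrite lee_fin sqr_ge0.
  - apply: (@measurable_fun_fubini_tonelli_F _ _ _ _ _ (iid_law P n)
      (fun z => ((c + \sum_(i < n.+1) w i *
        (tnth (tuple_cons z) i - mean P)) ^+ 2)%:E)).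
      by apply: (measurableT_comp (mf n.+1 w c)); exact: measurable_tuple_cons.
    by move=> z; rewrite lee_fin sqr_ge0.
  - exact: emeasurable_funD.
  (* The first sample is absorbed into the offset, which becomes [c + w ord0 * (x - mean P)]. *)
  move=> x _; apply: le_trans (IHn (fun i => w (lift ord0 i)) _).
  rewrite le_eqVlt; apply/orP; left; apply/eqP.
  apply: eq_integral => t _; rewrite big_ord_recl tnth0 addrA.
  by congr ((_ + _) ^+ 2)%:E; apply: eq_bigr => i _; rewrite tnthS.
rewrite ge0_integralD//; last first.
  by move=> x _; rewrite lee_fin sqr_ge0.
rewrite integral_cst// [X in _ + _ * X <= _](_ : _ = 1); last first.
  exact: probability_setT.
rewrite mule1 big_ord_recl mulrDr addrA [leRHS]EFinD leeD2r//.
exact: integral_sq_affine_le.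
Qed.

End sample_mean.

(** * Choice of the truncation level *)

Section truncation_level.
Context {R : realType}.
Local Open Scope ring_scope.

(** Monotonicity makes the levels below [t] an initial segment, matching the prefix sums of
    [effective_size]; [k] is the least index from which all levels are at least [t]. *)
Lemma sorted_threshold n (eps : 'I_n -> R) (t : R) :
  (forall i j : 'I_n, (i <= j)%N -> eps i <= eps j) ->
  exists2 k, (k <= n)%N & forall i : 'I_n, (i < k)%N = (eps i < t).
Proof.
move=> eps_nd.
pose p k := (k <= n)%N && [forall i : 'I_n, (k <= i)%N ==> (t <= eps i)].
have pn : exists k, p k.
  exists n; rewrite /p leqnn; apply/forallP => i.
  by rewrite leqNgt ltn_ord.
have [k /andP[kn /forallP kP] kmin] := ex_minnP pn.
exists k => // i; rewrite [RHS]ltNge; apply/idP/idP; last first.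
  by apply: contraR; rewrite -leqNgt; have /implyP := kP i.
move=> ik; apply/negP => ti; move: ik; rewrite ltnNge => /negP; apply; apply: kmin.
rewrite /p ltnW//; apply/forallP => j; apply/implyP => ij.
exact: le_trans ti (eps_nd _ _ ij).
Qed.

(** [g] is continuous with [g 0 = 0]: it reaches 1 on the unit interval by the intermediate value
    theorem, unless [g 1 < 1]. *)
Lemma exists_truncation_level n (eps : 'I_n -> R) :
  (forall i, 0 <= eps i <= 1) ->
  exists2 t, 0 <= t <= 1 &
    let g := t * \sum_i Num.min (eps i) t in g = 1 \/ (t = 1 /\ g < 1).
Proof.
move=> e01; pose g t := t * \sum_i Num.min (eps i) t.
have [g1|g1] := ltP (g 1) 1.
  by exists 1; [rewrite ler01 lexx|right].
have cg : continuous g.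
  move=> t; apply: (@continuousM _ R^o id); first exact: cvg_id.
  apply: continuous_big; first exact: add_continuous.
  move=> i _ u; apply: (@continuous_min _ R^o); [exact: cst_continuous|exact: cvg_id].
have [||t t01 gt] := @IVT R g 0 1 1 ler01.
- exact: continuous_subspaceT.
- by rewrite {1 3}/g mul0r ge_min ler01 le_max g1 orbT.
by exists t; [move: t01; rewrite in_itv|left].
Qed.

Lemma truncation_bounds n (eps : 'I_n -> R) :
  (forall i, 0 <= eps i <= 1) ->
  (forall i j : 'I_n, (i <= j)%N -> eps i <= eps j) ->
  (exists i, 0 < eps i) ->
  exists t : R, let s := \sum_i Num.min (eps i) t in
    [/\ 0 <= t, 0 < s, t * s <= 1 &
        exists2 k, (k <= n)%N & effective_size eps k <= s ^+ 2].
Proof.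
move=> e01 eps_nd [i0 ei0].
have [t /andP[t0 t1] gt] := exists_truncation_level e01.
have m0 i : 0 <= Num.min (eps i) t.
  by rewrite le_min t0 andbT; case/andP: (e01 i).
exists t => /=; set s := \sum_i _ in gt *.
(* When [t * s = 1], [s] cannot vanish; when [t = 1], the positive level [eps i0] makes the sum
   positive. *)
have s0 : 0 < s.
  case: gt => [ts1|[t1' _]].
    have : 0 <= s by exact: sumr_ge0.
    rewrite le0r => /orP[/eqP sE|//]; move: ts1; rewrite sE mulr0 => /esym/eqP.
    by rewrite oner_eq0.
  rewrite /s (bigD1 i0)//= ltr_pwDl ?sumr_ge0// lt_min ei0 t1' ltr01//.
split => //; first by case: gt => [->//|[_ /ltW]].
case: gt => [ts1|[tE _]]; last first.
  (* At [t = 1] nothing is truncated, and [k = n] leaves exactly the square of the full sum. *)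
  exists n => //; rewrite /effective_size subnn add0r /s.
  rewrite (_ : \sum_(i < n | _) _ = \sum_i Num.min (eps i) t)//.
  apply: eq_big => i; rewrite ?ltn_ord// => _.
  by rewrite (min_idPl _)// tE; case/andP: (e01 i).
have [k kn kP] := sorted_threshold t eps_nd; exists k => //.
rewrite /effective_size; set S := \sum_(i < n | _) _.
have sE : s = S + (n - k)%:R * t.
  rewrite /s (bigID (fun i : 'I_n => (i < k)%N))/=; congr (_ + _).
    apply: eq_bigr => i; rewrite kP => it.
    by rewrite (min_idPl _)// ltW.
  rewrite (eq_bigr (fun=> t)) => [|i]; last first.
    by rewrite kP -leNgt => ti; rewrite (min_idPr _).
  by rewrite sumr_const card_ord_ge// mulr_natl.
have S0 : 0 <= S by apply: sumr_ge0 => i _; case/andP: (e01 i).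
have Ss : S <= s by rewrite sE lerDl mulr_ge0.
(* Expand one factor by [sE] and use [t * s = 1] on the second term. *)
have -> : s ^+ 2 = s * S + (n - k)%:R.
  by rewrite expr2 {2}sE -[X in _ = _ + X]mulr1 -ts1; ring.
by rewrite addrC lerD2r expr2 ler_wpM2r.
Qed.

End truncation_level.

(** * The private linear estimator attaining the upper bound *)

Section upper_bound.
Context {R : realType}.
Local Notation mR := (measurableTypeR R).

Lemma exists_linear_mechanism n (eps : 'I_n -> R) :
  (forall i, 0 <= eps i <= 1)%R ->
  (forall i j : 'I_n, (i <= j)%N -> (eps i <= eps j)%R) ->
  (exists i, (0 < eps i)%R) ->
  exists2 k, (k <= n)%N &
    exists2 s : R, (0 < s)%R /\ (effective_size eps k <= s ^+ 2)%R &
    exists A : estimator n,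
    [/\ central_dp eps A, exists w eta, linear_estimator w eta A &
        forall P, bounded_laws P ->
          mean_squared_error mean A P <= (65 / s ^+ 2)%:E].
Proof.
move=> e01 eps_nd e0.
have [t /= [t0 s0 ts [k kn Nk]]] := truncation_bounds e01 eps_nd e0.
set s := (\sum_i _)%R in s0 ts Nk.
exists k => //; exists s => //.
have sV0 : (0 < s^-1)%R by rewrite invr_gt0.
pose b : {posnum R} := PosNum sV0.
pose w i := (Num.min (eps i) t / s)%R.
have m0 i : (0 <= Num.min (eps i) t)%R.
  by rewrite le_min t0 andbT; case/andP: (e01 i).
have w1 : (\sum_(i < n) w i = 1)%R by rewrite -mulr_suml divff// gt_eqF.
(* One factor of each squared numerator is bounded by [t]; the sum of the other factors is [s], and
   [t * s <= 1]. *)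
have w2 : (\sum_(i < n) w i ^+ 2 <= s ^- 2)%R.
  apply: (@le_trans _ _ (\sum_(i < n) t * Num.min (eps i) t / s ^+ 2)%R).
    apply: ler_sum => i _; rewrite /w expr_div_n ler_wpM2r ?invr_ge0 ?sqr_ge0//.
    by rewrite expr2 ler_wpM2r// ge_min lexx orbT.
  by rewrite -mulr_suml -mulr_sumr -/s -[leRHS]mul1r ler_wpM2r// invr_ge0 sqr_ge0.
exists (linear_mechanism w b); split.
- apply: linear_mechanism_dp => i; rewrite /w ger0_norm ?divr_ge0 ?(ltW s0)//.
  by rewrite /= [leLHS]mulrC ler_wpM2l ?(ltW sV0)// ge_min lexx.
- by exists w, (b%:num^-1)%R; exact: linear_mechanism_linear.
move=> P bP; apply: le_trans; first apply: linear_mechanism_mse_le.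
  have := integral_iid_sq_le bP w 0; rewrite expr0n /= add0r.
  apply: le_trans; rewrite le_eqVlt; apply/orP; left; apply/eqP.
  (* As the weights sum to 1, subtracting the mean from the linear form centers each sample. *)
  apply: eq_integral => x _; rewrite /linear_form add0r.
  congr ((_ ^+ 2)%:E); under [RHS]eq_bigr do rewrite mulrBr.
  by rewrite sumrB -mulr_suml w1 mul1r.
(* Sampling contributes at most [v / 2] and noise [64 * v], which 65 covers. *)
rewrite lee_fin /= exprVn; move: w2; set v := (s ^- 2)%R => w2.
have v0 : (0 <= v)%R by rewrite invr_ge0 sqr_ge0.
lra.
Qed.

End upper_bound.

(** * The two bounds with universal constants *)

Theorem theorem1 (R : realType) :
  (exists cl : R, (0 < cl)%R /\
    forall (n : nat) (eps : 'I_n -> R),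
      (0 < n)%N ->
      (forall i, (0 <= eps i <= 1)%R) ->
      (forall i j : 'I_n, (i <= j)%N -> (eps i <= eps j)%R) ->
      cl%:E * mine (\big[maxe/-oo]_(k < n.+1) (effective_size eps k)%:E^-1) 1
        <= minimax_error bounded_laws mean eps)
  /\
  (exists cu : R,
    forall (n : nat) (eps : 'I_n -> R),
      (0 < n)%N ->
      (forall i, (0 <= eps i <= 1)%R) ->
      (forall i j : 'I_n, (i <= j)%N -> (eps i <= eps j)%R) ->
      (exists i, (0 < eps i)%R) ->
      exists A : estimator n,
        [/\ central_dp eps A,
            exists (w : 'I_n -> R) (eta : R), linear_estimator w eta A &
            forall P, bounded_laws P ->
              mean_squared_error mean A P <=
              cu%:E * \big[maxe/-oo]_(k < n.+1)
                        ((ln n.+1%:R)%:E / (effective_size eps k)%:E)]).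
Proof.
have N0 n (eps : 'I_n -> R) k : (0 <= effective_size eps k)%R.
  by rewrite addr_ge0// sqr_ge0.
split.
  exists (2048^-1)%R; split; first by rewrite invr_gt0 ltr0n.
  move=> n eps _ e01 _.
  have [k ->] : exists k : 'I_n.+1,
      \big[maxe/-oo]_(k < n.+1) (effective_size eps k)%:E^-1 =
      (effective_size eps k)%:E^-1.
    exists [arg max_(k > ord0) (effective_size eps (k : 'I_n.+1))%:E^-1]%O.
    by apply: bigmax_eq_arg => // k _; exact: leNye.
  have kn : (k <= n)%N by rewrite -ltnS.
  apply: le_trans (minimax_error_ge e01 kn).
  rewrite invfM EFinM; apply: lee_wpmul2l; first by rewrite lee_fin invr_ge0 ler0n.
  rewrite ge_min; set N := effective_size eps k.
  (* The first case includes [N = 0], where the inverse is [+oo] and the cap at 1 gives the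
     bound. *)
  have [N1|N1] := leP N 1%R.
    by rewrite invr1 lexx orbT.
  by rewrite inver (gt_eqF (lt_trans _ N1))// lexx.
have ln20 : (0 < ln 2 :> R)%R by rewrite ln_gt0// ltr1n.
(* The estimator has error at most [65 / N]; since [n >= 1], [ln (n + 1) / ln 2 >= 1] and the
   logarithm can be inserted for free. *)
exists (65 / ln 2)%R => n eps n0 e01 eps_nd e0.
have [k kn [s [s0 Nk] [A [dpA linA mseA]]]] := exists_linear_mechanism e01 eps_nd e0.
exists A; split => // P bP; apply: (le_trans (mseA P bP)).
have c0 : (0 < 65 / ln 2 :> R)%R by rewrite divr_gt0.
have ln_le : (ln 2 <= ln n.+1%:R :> R)%R by rewrite ler_ln ?posrE// ler_nat.
pose K : 'I_n.+1 := Ordinal (kn : (k < n.+1)%N).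
apply: (@le_trans _ _ ((65 / ln 2)%:E *
    ((ln n.+1%:R)%:E / (effective_size eps K)%:E))); last first.
  apply: lee_wpmul2l; first by rewrite lee_fin ltW.
  exact: (le_bigmax _ (fun k : 'I_n.+1 => (ln n.+1%:R)%:E / (effective_size eps k)%:E)).
rewrite inver /=; case: ifPn => [_|Nn0].
  by rewrite gt0_muley ?lte_fin ?(lt_le_trans ln20)// gt0_muley ?lte_fin// leey.
have N_gt0 : (0 < effective_size eps k)%R by rewrite lt_neqAle eq_sym Nn0 N0.
rewrite -!EFinM lee_fin.
apply: (@le_trans _ _ (65 / effective_size eps k)%R).
  by rewrite ler_wpM2l// lef_pV2 ?posrE// exprn_gt0.
rewrite mulrA ler_wpM2r ?invr_ge0//.
by rewrite mulrAC ler_pdivlMr// ler_wpM2l.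
Qed.
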